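(* Let $1\le t<k$ and $s\ge1$ be integers with $k\ge 3$. There exists $n_0=n_0(k,t,s)$ such that for all $n\ge n_0$ and every $\mathcal{F}\subseteq\binom{[n]}{k}$ with $\nu_t(\mathcal{F})=s<\tau_t(\mathcal{F})$, we have $|\mathcal{F}|\le|\mathcal{H}_t^{(k)}(n,s)|$, where: (i) if $t+1\le k\le 2t+1$, $$\mathcal{H}_t^{(k)}(n,s)=\Big\{F\in\tbinom{[n]}{k}:[(r-1)t+1,rt]\subseteq F\text{ for some }1\le r\le s-1\Big\}\cup\Big\{F\in\tbinom{[n]}{k}:|F\cap[(s-1)t+1,st+2]|\ge t+1\Big\};$$ (ii) if $k>2t+1$, $$\mathcal{H}_t^{(k)}(n,s)=\Big\{F\in\tbinom{[n]}{k}:[(r-1)t+1,rt]\subseteq F\text{ for some }1\le r\le s-1\Big\}\cup\Big\{F\in\tbinom{[n]}{k}:[(s-1)t+1,st]\subseteq F,\ F\cap[st+1,(s-1)t+k+1]\ne\emptyset\Big\}$$ $$\cup\Big\{[(s-1)t+1,(s-1)t+k+1]\setminus\{i\}:(s-1)t+1\le i\le (s-1)t+k+1\Big\}.$$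
   Context: $[a,b]=\{a,a+1,\dots,b\}$, $[n]=[1,n]$, and $\binom{[n]}{k}$ is the family of $k$-subsets of $[n]$. A $t$-matching of size $m$ is a collection of $m$ distinct sets $A_1,\dots,A_m\in\binom{[n]}{k}$ with $|A_i\cap A_j|<t$ for all $i\ne j$; $\nu_t(\mathcal{F})$ is the maximum size of a $t$-matching contained in $\mathcal{F}$. A family $\mathcal{C}\subseteq\binom{[n]}{t}$ is a $t$-covering family of $\mathcal{F}$ if every $F\in\mathcal{F}$ contains some $C\in\mathcal{C}$; $\tau_t(\mathcal{F})$ is the minimum size of a $t$-covering family of $\mathcal{F}$. *)

(* Defs.v *)
From mathcomp Require Import all_boot.

Set Implicit Arguments.
Unset Strict Implicit.
Unset Printing Implicit Defensive.

(* The element i : 'I_n stands for the integer i.+1 of [n] = {1, ..., n}, so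
   that all interval bounds below are 1-based. *)

(* [a, b], cut down to [n] when b > n. *)
Definition itv (n a b : nat) : {set 'I_n} := [set i : 'I_n | a <= i.+1 <= b].

Definition ksubsets (n k : nat) : {set {set 'I_n}} :=
  [set A : {set 'I_n} | #|A| == k].

(* Uniformity of the members is not repeated here: nu only considers
   subfamilies M of a given k-uniform family. *)
Definition t_matching (n t : nat) (M : {set {set 'I_n}}) : bool :=
  [forall A in M, forall B in M, (A != B) ==> (#|A :&: B| < t)].

Definition nu (n t : nat) (F : {set {set 'I_n}}) : nat :=
  \max_(M : {set {set 'I_n}} | (M \subset F) && t_matching t M) #|M|.

Definition t_covering (n t : nat) (F C : {set {set 'I_n}}) : bool :=
  (C \subset ksubsets n t) &&
  [forall A in F, [exists B in C, B \subset A]].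

(* ksubsets n t is itself a t-covering family of F as soon as every member of F
   has at least t elements, so this is a genuine minimum for k-uniform F with
   t <= k. *)
Definition tau (n t : nat) (F : {set {set 'I_n}}) : nat :=
  #|[arg min_(C < ksubsets n t | t_covering t F C) #|C|]|.

Definition stars (n k t s : nat) : {set {set 'I_n}} :=
  [set A in ksubsets n k |
    [exists r : 'I_s, (1 <= r) && (itv n ((r - 1) * t + 1) (r * t) \subset A)]].

Definition extremal_family (n k t s : nat) : {set {set 'I_n}} :=
  if k <= 2 * t + 1 then
    stars n k t s
    :|: [set A in ksubsets n k |
          t + 1 <= #|A :&: itv n ((s - 1) * t + 1) (s * t + 2)|]
  else
    stars n k t s
    :|: [set A in ksubsets n k |
          (itv n ((s - 1) * t + 1) (s * t) \subset A)
          && (A :&: itv n (s * t + 1) ((s - 1) * t + k + 1) != set0)]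
    :|: [set itv n ((s - 1) * t + 1) ((s - 1) * t + k + 1) :\ i
          | i in itv n ((s - 1) * t + 1) ((s - 1) * t + k + 1)].

(* Main.v *)
Require Import Defs.
From mathcomp Require Import all_boot perm zify.

Set Implicit Arguments.
Unset Strict Implicit.
Unset Printing Implicit Defensive.

(* Call a t-set heavy if it lies in more than a constant times n^(k-t-1) members
   of F.  A matching whose members contain no heavy set extends greedily by one
   member through each heavy set, so nu = s < tau leaves at most s - 1 heavy
   sets.  The members G containing none of them number O(n^(k-t-1)), hence F is
   too small unless there are exactly s - 1 heavy sets, and then G is
   t-intersecting without a common t-subset.

   One level up, the heavy (t+1)-sets of G pairwise meet in t points: they form a
   clique inside a (t+2)-set or a flower with a t-element kernel and at most
   k-t+1 petals.  So either G has a smaller leading coefficient than the extremal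
   core, or G lies in a core of one of the two extremal shapes.  A permutation of
   [n] settles the case where the heavy t-sets and the support of the core are
   pairwise disjoint.  Any intersection between them costs a term of the order of
   the degree of a set of size at most 2t (2t-1 for two heavy sets), which
   outweighs the overlap, of the order of the degree of a (2t+1)-set (2t for
   two heavy sets), in the extremal family. *)

(** * Degrees and up-sets *)

(** The number of [k]-subsets of the ground set through a fixed [j]-set. The test [j <= k] matters:
    with truncated subtraction the binomial alone would give 1 for [j > k]. *)
Definition deg (n k j : nat) : nat := if j <= k then 'C(n - j, k - j) else 0.

Definition upset (n k : nat) (D : {set {set 'I_n}}) : {set {set 'I_n}} :=
  [set A in ksubsets n k | [exists T in D, T \subset A]].

Lemma ksubsetsE n k (A : {set 'I_n}) : (A \in ksubsets n k) = (#|A| == k).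
Proof. by rewrite inE. Qed.

Lemma upsetP n k (D : {set {set 'I_n}}) (A : {set 'I_n}) :
  reflect (#|A| = k /\ exists2 T, T \in D & T \subset A) (A \in upset k D).
Proof.
rewrite !inE; apply: (iffP andP) => [[/eqP -> /existsP[T /andP[TD TA]]]|].
  by split=> //; exists T.
by case=> -> [T TD TA]; split=> //; apply/existsP; exists T; rewrite TD.
Qed.

Lemma upset1P n k (U A : {set 'I_n}) :
  reflect (#|A| = k /\ U \subset A) (A \in upset k [set U]).
Proof.
apply: (iffP (upsetP k [set U] A)) => [[Ak [T /set1P -> UA]]|[Ak UA]] //.
by split=> //; exists U; rewrite ?set11.
Qed.

Lemma upsetS n k (D E : {set {set 'I_n}}) :
  D \subset E -> upset k D \subset upset k E.
Proof.
move=> /subsetP DE; apply/subsetP => A /upsetP[Ak [T /DE TE TA]].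
by apply/upsetP; split=> //; exists T.
Qed.

Lemma upsetU n k (D E : {set {set 'I_n}}) :
  upset k (D :|: E) = upset k D :|: upset k E.
Proof.
apply/eqP; rewrite eqEsubset subUset !upsetS ?subsetUl ?subsetUr // !andbT.
apply/subsetP => A /upsetP[Ak [T /setUP[TD|TE] TA]]; apply/setUP; [left|right];
  by apply/upsetP; split=> //; exists T.
Qed.

Lemma card_upset1 n k (U : {set 'I_n}) : #|upset k [set U]| = deg n k #|U|.
Proof.
rewrite /deg; case: leqP => [Uk|kU]; last first.
  apply/eqP; rewrite cards_eq0 -subset0; apply/subsetP => A /upset1P[Ak /subset_leq_card].
  by rewrite Ak leqNgt kU.
have <- : #|~: U| = n - #|U| by rewrite cardsCs setCK card_ord.
rewrite -(cards_draws (~: U) (k - #|U|)).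
rewrite -(@card_in_imset _ _ (fun B => U :|: B)); last first.
  move=> B C /[!inE] /andP[BU _] /andP[CU _] eBC.
  rewrite -(setIidPl BU) -(setIidPl CU) -!setDE.
  by rewrite -[B :\: U]setU0 -[C :\: U]setU0 -(setDv U) -!setDUl setUC eBC setUC.
apply: eq_card => A; apply/upset1P/imsetP => [[Ak UA]|[B]].
  exists (A :\: U); last by rewrite setUC setDE setUIl setUC (setUC _ U) setUCr setIT (setUidPr UA).
  by rewrite inE setDE subsetIr -setDE cardsD (setIidPr UA) Ak eqxx.
rewrite inE => /andP[BU /eqP Bk] ->; split; last exact: subsetUl.
rewrite cardsU disjoint_setI0 ?cards0 ?subn0 ?Bk ?subnKC //.
by rewrite disjoint_sym disjoints_subset.
Qed.

(** By absorption, [(k - j) * deg n k j = (n - j) * deg n k j.+1], and the ratio [(n - j) / (k - j)]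
    is at least [c] for such [n]. *)
Lemma leq_deg_mul n k c j : c * k + k <= n -> c * deg n k j.+1 <= deg n k j.
Proof.
move=> nk; rewrite /deg.
case: (ltnP j k) => [jk|kj]; last by rewrite muln0.
rewrite (ltnW jk).
have := mul_bin_diag (n - j) (k - j.+1).
have -> : (n - j).-1 = n - j.+1 by lia.
have -> : (k - j.+1).+1 = k - j by lia.
move=> e; have kj : 0 < k - j by lia.
rewrite -(leq_pmul2l kj) -e mulnA leq_mul2r; apply/orP; right; nia.
Qed.

(** The form in which [n] large enters the estimates: each further point in a set divides its degree
    by at least [m], so lower-order terms are absorbed by one term of higher order. *)
Definition gap (n k m : nat) : Prop := forall j, m * deg n k j.+1 <= deg n k j.

Lemma gap_le n k m c j i : gap n k m -> c <= m -> 0 < m -> j < i ->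
  c * deg n k i <= deg n k j.
Proof.
move=> g cm m0; elim: i => // i IH; rewrite ltnS leq_eqVlt => /orP[/eqP ->|ji].
  by apply: leq_trans (g i); rewrite leq_mul2r cm orbT.
apply: leq_trans (IH ji); rewrite leq_mul2l; apply/orP; right.
by apply: leq_trans (g i); rewrite leq_pmull.
Qed.

Lemma gap_anti n k m j i : gap n k m -> 0 < m -> j <= i -> deg n k i <= deg n k j.
Proof.
move=> g m0; rewrite leq_eqVlt => /orP[/eqP -> //|ji].
by rewrite -[leqLHS]mul1n; apply: gap_le ji.
Qed.

Lemma card_upset_sum n k (D : {set {set 'I_n}}) :
  #|upset k D| <= \sum_(T in D) deg n k #|T|.
Proof.
have -> : upset k D = \bigcup_(T in D) upset k [set T].
  apply/setP => A; apply/upsetP/bigcupP => [[Ak [T TD TA]]|[T TD /upset1P[Ak TA]]].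
    by exists T => //; apply/upset1P.
  by split=> //; exists T.
elim/big_rec2: _ => [|T m B TD IH]; first by rewrite cards0.
by rewrite -card_upset1 (leq_trans (leq_card_setU _ _)) // leq_add2l.
Qed.

Lemma card_upset_le n k j (D : {set {set 'I_n}}) :
  {in D, forall T : {set 'I_n}, deg n k #|T| <= deg n k j} -> #|upset k D| <= #|D| * deg n k j.
Proof.
move=> h; apply: leq_trans (card_upset_sum k D) _.
by rewrite -sum_nat_const; apply: leq_sum => T /h.
Qed.

Lemma card_upsetI_le n k u (D E : {set {set 'I_n}}) :
  {in D & E, forall T T' : {set 'I_n}, deg n k #|T :|: T'| <= deg n k u} ->
  #|upset k D :&: upset k E| <= #|D| * #|E| * deg n k u.
Proof.
move=> h.
apply: leq_trans (_ : #|upset k [set T :|: T' | T in D, T' in E]| <= _).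
  apply: subset_leq_card; apply/subsetP => A /setIP[/upsetP[Ak [T TD TA]] /upsetP[_ [T' TE TA']]].
  by apply/upsetP; split=> //; exists (T :|: T'); [exact: imset2_f | rewrite subUset TA].
apply: leq_trans (card_upset_le (j := u) _) _.
  by move=> _ /imset2P[T T' TD TE ->]; exact: h.
rewrite leq_mul2r; apply/orP; right.
by rewrite curry_imset2X -cardsX leq_imset_card.
Qed.

(** A Bonferroni bound, by induction on [D]: a new generator loses at most its overlaps with the
    others, each at most [deg n k u]. The number of pairs is bounded crudely by the square of
    [#|D|]. *)
Lemma card_upset_ge n k j u (D : {set {set 'I_n}}) :
  {in D, forall T : {set 'I_n}, #|T| = j} ->
  {in D &, forall T T' : {set 'I_n}, T != T' -> deg n k #|T :|: T'| <= deg n k u} ->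
  #|D| * deg n k j <= #|upset k D| + #|D| * #|D| * deg n k u.
Proof.
move: {2}#|D| (erefl #|D|) => m; elim: m D => [|m IH] D Dm Dj Du; first by rewrite Dm.
have [T TD] : exists T, T \in D by apply/card_gt0P; rewrite Dm.
have Dm' : #|D :\ T| = m by have := cardsD1 T D; rewrite TD Dm; lia.
have {}IH : #|D :\ T| * deg n k j <=
    #|upset k (D :\ T)| + #|D :\ T| * #|D :\ T| * deg n k u.
  apply: IH => // [A|A B]; first by case/setD1P => _ /Dj.
  by case/setD1P => _ AD; case/setD1P => _ BD; exact: Du.
have hI : #|upset k [set T] :&: upset k (D :\ T)| <= #|[set T]| * #|D :\ T| * deg n k u.
  by apply: card_upsetI_le => A B /set1P -> /setD1P[nB BD]; apply: Du => //; rewrite eq_sym.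
have hU : upset k D = upset k [set T] :|: upset k (D :\ T) by rewrite -upsetU setD1K.
have := cardsUI (upset k [set T]) (upset k (D :\ T)).
rewrite -hU card_upset1 (Dj _ TD); rewrite Dm' in IH hI; rewrite cards1 mul1n in hI.
rewrite Dm; nia.
Qed.

(** In the union bound, the members through [T :|: T'] are counted at least twice. *)
Lemma card_upset_pair n k j (D : {set {set 'I_n}}) (T T' : {set 'I_n}) :
  {in D, forall T : {set 'I_n}, #|T| = j} -> T \in D -> T' \in D -> T != T' ->
  #|upset k D| + deg n k #|T :|: T'| <= #|D| * deg n k j.
Proof.
move=> Dj TD TD' nT.
have hU : upset k D = upset k [set T] :|: upset k (D :\ T) by rewrite -upsetU setD1K.
have hI : deg n k #|T :|: T'| <= #|upset k [set T] :&: upset k (D :\ T)|.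
  rewrite -card_upset1; apply: subset_leq_card; apply/subsetP => A /upset1P[Ak].
  rewrite subUset => /andP[TA TA']; apply/setIP; split; first exact/upset1P.
  by apply/upsetP; split=> //; exists T' => //; apply/setD1P; rewrite eq_sym.
have hD : #|upset k (D :\ T)| <= #|D :\ T| * deg n k j.
  by apply: card_upset_le => A /setD1P[_ /Dj ->].
have := cardsUI (upset k [set T]) (upset k (D :\ T)).
rewrite -hU card_upset1 (Dj _ TD) (cardsD1 T D) TD /= mulnDl mul1n => e.
by apply: leq_trans (leq_add (leqnn _) hD); rewrite -e leq_add2l.
Qed.

(** * Heavy sets and greedy matchings *)

(** The threshold is the number of [k]-sets that can contain a [j]-set [T] and one of [c] given
    points outside it. A heavy set thus has a member avoiding any [c] such points. *)
Definition heavy (n k c j : nat) (F : {set {set 'I_n}}) : {set {set 'I_n}} :=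
  [set T in ksubsets n j | c * deg n k j.+1 < #|[set A in F | T \subset A]|].

Lemma heavyP n k c j (F : {set {set 'I_n}}) (T : {set 'I_n}) :
  reflect (#|T| = j /\ c * deg n k j.+1 < #|[set A in F | T \subset A]|)
    (T \in heavy k c j F).
Proof. by rewrite !inE; apply: (iffP andP) => [[/eqP]|[->]]. Qed.

Lemma heavy_avoid n k c (F : {set {set 'I_n}}) (U Z : {set 'I_n}) :
  F \subset ksubsets n k -> U \in heavy k c #|U| F -> #|Z| <= c ->
  exists A, [/\ A \in F, U \subset A & A :&: Z \subset U].
Proof.
move=> /subsetP Fk /heavyP[_ Uh] Zc.
case: (pickP [pred A in F | (U \subset A) && (A :&: Z \subset U)]) => [A|h].
  by case/and3P => ? ? ?; exists A.
suff /(leq_trans Uh) : #|[set A in F | U \subset A]| <= c * deg n k #|U|.+1 by rewrite ltnn.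
(* If no member avoids [Z] outside [U], every member through [U] contains [U] and one more point of
   [Z]. *)
pose D := [set z |: U | z in Z :\: U].
apply: leq_trans (_ : #|upset k D| <= _).
  apply: subset_leq_card; apply/subsetP => A; rewrite inE => /andP[AF UA].
  have /= := h A; rewrite AF UA /= => /negbT /subsetPn[z /setIP[zA zZ] zU].
  have := Fk A AF; rewrite inE => /eqP Ak.
  apply/upsetP; split=> //; exists (z |: U); last by rewrite subUset sub1set zA.
  by apply: imset_f; rewrite inE zU.
apply: leq_trans (card_upset_le (j := #|U|.+1) _) _.
  by move=> _ /imsetP[z /setDP[_ zU] ->]; rewrite cardsU1 zU.
rewrite leq_mul2r; apply/orP; right.
by apply: leq_trans (leq_imset_card _ _) _; apply: leq_trans Zc; apply/subset_leq_card/subsetDl.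
Qed.

Lemma card_bigcup_le (I J : finType) (M : {set I}) (f : I -> {set J}) b :
  {in M, forall i, #|f i| <= b} -> #|\bigcup_(i in M) f i| <= #|M| * b.
Proof.
move=> h; rewrite -sum_nat_const.
elim/big_rec2: _ => [|i m B iM IH]; first by rewrite cards0.
by rewrite (leq_trans (leq_card_setU _ _)) // leq_add // h.
Qed.

Lemma card_covered_le n (G D : {set {set 'I_n}}) x :
  {in G, forall A : {set 'I_n}, exists2 T, T \in D & T \subset A} ->
  {in D, forall T : {set 'I_n}, #|[set A in G | T \subset A]| <= x} ->
  #|G| <= #|D| * x.
Proof.
move=> GD Dx.
apply: leq_trans (_ : #|\bigcup_(T in D) [set A in G | T \subset A]| <= _).
  apply: subset_leq_card; apply/subsetP => A AG; have [T TD TA] := GD A AG.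
  by apply/bigcupP; exists T; rewrite // inE AG.
exact: card_bigcup_le.
Qed.

Lemma t_matchingP n t (M : {set {set 'I_n}}) :
  reflect {in M &, forall A B : {set 'I_n}, A != B -> #|A :&: B| < t} (t_matching t M).
Proof.
apply: (iffP forall_inP) => [h A B AM BM|h A AM].
  by move/forall_inP: (h A AM) => /(_ B BM) /implyP.
by apply/forall_inP => B BM; apply/implyP; exact: h.
Qed.

Lemma leq_nu n t (F M : {set {set 'I_n}}) :
  M \subset F -> t_matching t M -> #|M| <= nu t F.
Proof.
move=> MF Mt; rewrite /nu.
by rewrite (bigD1 M) ?MF //= leq_maxl.
Qed.

Lemma t_matchingU1 n t (M : {set {set 'I_n}}) (A : {set 'I_n}) :
  t_matching t M -> {in M, forall B : {set 'I_n}, #|A :&: B| < t} ->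
  t_matching t (A |: M).
Proof.
move=> /t_matchingP Mt AM; apply/t_matchingP => B C.
case/setU1P => [->|BM]; case/setU1P => [->|CM]; rewrite ?eqxx // => nBC.
- exact: AM.
- by rewrite setIC; exact: AM.
- exact: Mt.
Qed.

Lemma exists_subset_card (I : finType) m (A : {set I}) :
  m <= #|A| -> exists2 T : {set I}, T \subset A & #|T| = m.
Proof.
move=> tA; suff /card_gt0P[T] : 0 < #|[set B : {set I} | B \subset A & #|B| == m]|.
  by rewrite inE => /andP[TA /eqP]; exists T.
by rewrite cards_draws bin_gt0.
Qed.

Lemma tau_le n k t (F C : {set {set 'I_n}}) :
  F \subset ksubsets n k -> t <= k -> t_covering t F C -> tau t F <= #|C|.
Proof.
move=> /subsetP Fk tk CF; rewrite /tau; case: arg_minnP => [|D _]; last exact.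
rewrite /t_covering subxx; apply/forall_inP => A /Fk; rewrite inE => /eqP Ak.
have [T TA Tt] : exists2 T : {set 'I_n}, T \subset A & #|T| = t by apply: exists_subset_card; rewrite Ak.
by apply/existsP; exists T; rewrite inE Tt eqxx.
Qed.

(** Greedy choice: for each [T] in [S], add a member through [T] that avoids, outside [T], every
    point of the matching and of the sets of [S]. *)
Lemma extend_matching n k t m (F S M : {set {set 'I_n}}) :
  F \subset ksubsets n k -> S \subset heavy k (m * (k + t)) t F ->
  M \subset F -> t_matching t M ->
  {in M & S, forall A T : {set 'I_n}, ~~ (T \subset A)} ->
  #|M| + #|S| <= m ->
  exists2 M' : {set {set 'I_n}}, M' \subset F & t_matching t M' /\ #|M'| = #|M| + #|S|.
Proof.
move=> Fk; move: {2}#|S| (erefl #|S|) => p; elim: p S M => [|p IH] S M Sp SH MF Mt MS Sm.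
  by exists M; rewrite // Sp addn0.
have [T TS] : exists T, T \in S by apply/card_gt0P; rewrite Sp.
have Sp' : #|S :\ T| = p by have := cardsD1 T S; rewrite TS Sp; lia.
have Tt T' : T' \in S -> #|T'| = t by move=> /(subsetP SH) /heavyP[].
(* The points to avoid: at most [k] for each member of [M] and [t] for each set of [S], whence the
   threshold [m * (k + t)]. *)
pose Z := (\bigcup_(A in M) A) :|: \bigcup_(A in S) A.
have Zc : #|Z| <= m * (k + t).
  apply: leq_trans (leq_card_setU _ _) _.
  have h1 : #|\bigcup_(A in M) A| <= #|M| * k.
    by apply: card_bigcup_le => A /(subsetP MF) /(subsetP Fk); rewrite inE => /eqP ->.
  have h2 : #|\bigcup_(A in S) A| <= #|S| * t.
    by apply: card_bigcup_le => A /Tt ->.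
  nia.
have [|A [AF TA AZ]] := heavy_avoid Fk _ Zc (U := T).
  by rewrite Tt //; exact: (subsetP SH).
have AM : A \notin M by apply: contraL TA => AM; exact: MS.
have hM' : t_matching t (A |: M).
  apply: t_matchingU1 => // B BM; rewrite -(Tt T) //.
  (* The new member meets [B] only inside [T], and [B] does not contain [T], so fewer than [t]
     points are shared. *)
  have hs : A :&: B \subset T :&: B.
    rewrite subsetI subsetIr andbT; apply: subset_trans AZ; apply: setIS.
    by apply: subset_trans (subsetUl _ _); exact: bigcup_sup.
  apply: leq_ltn_trans (subset_leq_card hs) _; apply: proper_card.
  by rewrite properE subsetIl subsetI subxx MS.
have [||||M' M'F [M't M'c]] := IH (S :\ T) (A |: M) Sp' _ _ hM'.
- by apply: subset_trans (subsetDl _ _) SH.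
- by rewrite subUset sub1set AF.
(* The new member contains no other [T'] of [S]: it would meet [Z] in all of [T'], forcing [T']
   inside [T] and, by size, equal to it. *)
- move=> B T' /setU1P[->|BM] /setD1P[nT T'S]; last exact: MS.
  apply/negP => T'A; case/negP: nT; rewrite eqEcard !Tt // leqnn andbT.
  apply: subset_trans AZ; rewrite subsetI T'A.
  by apply: subset_trans (subsetUr _ _); exact: (bigcup_sup T').
- by rewrite cardsU1 AM Sp' add1n addSnnS -Sp.
by exists M' => //; split=> //; rewrite M'c cardsU1 AM Sp' Sp add1n addSnnS.
Qed.


Lemma matching_heavy_le n k t (F M : {set {set 'I_n}}) :
  let H := heavy k ((nu t F).+1 * (k + t)) t F in
  F \subset ksubsets n k -> M \subset F :\: upset k H -> t_matching t M ->
  #|M| + #|H| <= nu t F.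
Proof.
move=> H Fk /subsetP MG Mt; rewrite leqNgt; apply/negP => lt.
have MF : M \subset F by apply/subsetP => A /MG /setDP[].
have Mn := leq_nu MF Mt.
(* Just enough heavy sets are kept for the extended matching to have [nu t F + 1] members, one too
   many. *)
have [|S SH Sc] := @exists_subset_card _ ((nu t F).+1 - #|M|) H; first lia.
have [||M' M'F [M't M'c]] := extend_matching Fk SH MF Mt.
- move=> A T AM /(subsetP SH) TH; apply/negP => TA.
  have /setDP[AF /negP[]] := MG A AM; apply/upsetP.
  by split; [have := subsetP Fk A AF; rewrite inE => /eqP | exists T].
- by rewrite Sc; lia.
by have := leq_nu M'F M't; rewrite M'c Sc; lia.
Qed.

(** [G] consists of the members containing no heavy set. Both hypotheses act through [H]: a matching
    in [G] has at most [nu t F - #|H|] members, while covering [G] takes more than [nu t F - #|H|]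
    sets of size [t]. *)
Lemma heavy_reduction n k t (F : {set {set 'I_n}}) (c := (nu t F).+1 * (k + t))
    (H := heavy k c t F) (G := F :\: upset k H) :
  F \subset ksubsets n k -> t <= k -> nu t F < tau t F ->
  [/\ #|H| < nu t F,
      #|G| <= nu t F * 'C(k, t) * (c * deg n k t.+1) &
      #|H| = (nu t F).-1 ->
        {in G &, forall A B : {set 'I_n}, t <= #|A :&: B|} /\
        (forall T : {set 'I_n}, #|T| = t -> exists2 A, A \in G & ~~ (T \subset A))].
Proof.
move=> Fk tk st.
have Ht T : T \in H -> #|T| = t by case/heavyP.
have mle (M : {set {set 'I_n}}) : M \subset G -> t_matching t M -> #|M| + #|H| <= nu t F.
  exact: matching_heavy_le.
have Ak A : A \in F -> #|A| = k by move/(subsetP Fk); rewrite inE => /eqP.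
have notG A : A \in F -> A \notin G -> exists2 T, T \in H & T \subset A.
  by move=> AF; rewrite inE AF andbT negbK => /upsetP[].
have GT A T : A \in G -> T \in H -> ~~ (T \subset A).
  case/setDP => AF /negP AH TH; apply/negP => TA; apply: AH; apply/upsetP.
  by split; [exact: Ak | exists T].
have cov (D : {set {set 'I_n}}) : D \subset ksubsets n t ->
    {in G, forall A : {set 'I_n}, exists2 T, T \in D & T \subset A} ->
    nu t F < #|H| + #|D|.
  move=> Dt DG; apply: leq_trans st (leq_trans _ (leq_card_setU H D)).
  apply: tau_le Fk tk _; rewrite /t_covering subUset Dt andbT; apply/andP; split.
    by apply/subsetP => T /Ht Tt; rewrite inE Tt.
  apply/forall_inP => A AF; apply/existsP.
  have [/DG[T TD TA]|/(notG A AF)[T TH TA]] := boolP (A \in G).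
    by exists T; rewrite inE TD orbT.
  by exists T; rewrite inE TH.
have Hn : #|H| < nu t F.
  have t0 : t_matching t (set0 : {set {set 'I_n}}) by apply/t_matchingP => A B; rewrite inE.
  rewrite ltn_neqAle; apply/andP; split; last first.
    by have := mle _ (sub0set _) t0; rewrite cards0.
  (* With [nu t F] heavy sets, either [G] is empty and [H] covers [F], or a single member of [G] is
     already too large a matching. *)
  apply/eqP => Hn.
  have [G0|[A AG]] := set_0Vmem G.
    have := cov set0 (sub0set _); rewrite cards0 addn0 Hn ltnn.
    by move=> h; have : false by apply: h => A; rewrite G0 inE.
  have := mle [set A]; rewrite sub1set AG cards1 Hn add1n ltnn => h.
  suff : false by [].
  by apply: h => //; apply/t_matchingP => B C /set1P -> /set1P ->; rewrite eqxx.
split=> //.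
(* By maximality of [M], each member of [G] shares a [t]-set with some member of [M]. Such a [t]-set
   is not heavy if it lies in a member of [G], so it accounts for few of them. *)
- pose P (M : {set {set 'I_n}}) := (M \subset G) && t_matching t M.
  have P0 : P set0 by rewrite /P sub0set; apply/t_matchingP => A B; rewrite inE.
  case: (arg_maxnP (fun M : {set {set 'I_n}} => #|M|) P0) => M /andP[MG Mt] Mmax.
  pose D := \bigcup_(B in M) [set T : {set 'I_n} | T \subset B & #|T| == t].
  apply: leq_trans (@card_covered_le _ G D (c * deg n k t.+1) _ _) _.
  + move=> A AG; case: (pickP [pred B in M | t <= #|A :&: B|]) => [B /andP[BM tB]|h].
      have [T] := exists_subset_card tB; rewrite subsetI => /andP[TA TB] Tt.
      by exists T => //; apply/bigcupP; exists B => //; rewrite inE TB Tt eqxx.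
    have AM : A \notin M.
      by have /= := h A; rewrite setIid Ak ?tk ?andbT => [->|]; case/setDP: AG.
    have : P (A |: M).
      rewrite /P subUset sub1set AG MG; apply: t_matchingU1 => // B BM.
      by have /= := h B; rewrite BM /= leqNgt => /negbFE.
    by move/Mmax; rewrite cardsU1 AM /= add1n ltnn.
  + move=> T /bigcupP[B _]; rewrite inE => /andP[_ /eqP Tt]; rewrite leqNgt; apply/negP => lt.
    have TH : T \in H.
      apply/heavyP; split=> //; apply: leq_trans lt _; apply: subset_leq_card.
      by apply/subsetP => A; rewrite !inE => /andP[/andP[_ ->] ->].
    have : 0 < #|[set A in G | T \subset A]| by lia.
    by case/card_gt0P => A; rewrite inE => /andP[AG TA]; have := GT A T AG TH; rewrite TA.
  rewrite leq_mul2r; apply/orP; right.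
  apply: leq_trans (card_bigcup_le (b := 'C(k, t)) _) _.
    move=> B /(subsetP MG) /setDP[BF _]; rewrite cards_draws Ak //.
  rewrite leq_mul2r; apply/orP; right; have := mle M MG Mt; lia.
(* Now a matching in [G] has at most one member, and one more [t]-set added to [H] cannot cover
   [F]. *)
move=> He; split.
  move=> A B AG BG; rewrite leqNgt; apply/negP => lt.
  have nAB : A != B.
    by apply: contraTneq lt => <-; rewrite setIid -leqNgt Ak //; case/setDP: AG.
  have /mle : [set A; B] \subset G by rewrite subUset !sub1set AG.
  rewrite cards2 nAB He => h; suff /h : t_matching t [set A; B] by lia.
  apply/t_matchingP => C D; rewrite !inE => /orP[] /eqP -> /orP[] /eqP -> //; rewrite ?eqxx //.
  by rewrite setIC.
move=> T Tt; case: (pickP [pred A in G | ~~ (T \subset A)]) => [A /andP[]|h]; first by exists A.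
have := cov [set T]; rewrite cards1 He => h'.
suff : nu t F < (nu t F).-1 + 1 by lia.
apply: h'; first by rewrite sub1set inE Tt.
by move=> A AG; exists T; rewrite ?set11 //; have /= := h A; rewrite AG /= => /negbFE.
Qed.

(** * Non-trivial t-intersecting families *)

(** Two of the sets meet in a [t]-set and have a union of size [t + 2]. Either all sets contain this
    intersection, or some set misses part of it and then all lie in the union. *)
Lemma sunflower_or_clique (I : finType) t (D : {set {set I}}) :
  {in D, forall B : {set I}, #|B| = t.+1} ->
  {in D &, forall B B' : {set I}, t <= #|B :&: B'|} -> 1 < #|D| ->
  (exists2 T : {set I}, #|T| = t & {in D, forall B : {set I}, T \subset B}) \/
  (exists2 W : {set I}, #|W| = t.+2 & {in D, forall B : {set I}, B \subset W}).
Proof.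
move=> Dt DI /card_gt1P[B1 [B2 [D1 D2 n12]]].
have T12 : #|B1 :&: B2| = t.
  apply/eqP; rewrite eqn_leq DI // andbT -ltnS -(Dt B1 D1); apply: proper_card.
  rewrite properE subsetIl subsetI subxx /=; apply: contra n12 => s12.
  by rewrite eqEcard s12 (Dt _ D1) (Dt _ D2) leqnn.
have W12 : #|B1 :|: B2| = t.+2 by rewrite cardsU T12 (Dt _ D1) (Dt _ D2); lia.
case: (pickP [pred B in D | ~~ (B1 :&: B2 \subset B)]) => [B3 /andP[D3 T3]|h]; last first.
  by left; exists (B1 :&: B2) => // B BD; have /= := h B; rewrite BD => /negbFE.
right; exists (B1 :|: B2) => //.
have nT (B : {set I}) : ~~ (B1 :&: B2 \subset B) -> #|B :&: (B1 :&: B2)| < t.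
  move=> TB; rewrite -T12; apply: proper_card.
  by rewrite properE subsetIr subsetI subxx andbT.
(* Inclusion-exclusion: [B] meets the union in at least [t + t - (t - 1)] points, which is all of
   [B]. *)
have nW (B : {set I}) : B \in D -> ~~ (B1 :&: B2 \subset B) -> B \subset B1 :|: B2.
  move=> BD /nT TB; apply/setIidPl/eqP; rewrite eqEcard subsetIl setIUr cardsU Dt //.
  have := DI B B1 BD D1; have := DI B B2 BD D2.
  by rewrite -setIIr; lia.
move=> B BD; case: (boolP (B1 :&: B2 \subset B)) => [TB|]; last exact: nW.
apply/negPn/negP => BW.
(* A set through the kernel but not inside the union meets the union in the kernel only, so it
   shares fewer than [t] points with [B3]. *)
have BT : B :&: (B1 :|: B2) = B1 :&: B2.
  apply/esym/eqP; rewrite eqEcard T12 subsetI TB /=; apply/andP; split.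
    by apply: subset_trans (subsetIl _ _) (subsetUl _ _).
  rewrite -ltnS -(Dt B BD); apply: proper_card.
  by rewrite properE subsetIl subsetI subxx.
suff h : B3 :&: B \subset B3 :&: (B1 :&: B2).
  have := leq_trans (DI B3 B D3 BD) (subset_leq_card h).
  by rewrite leqNgt nT.
by rewrite subsetI subsetIl -BT subsetI subsetIr (subset_trans (subsetIl _ _) (nW _ D3 T3)).
Qed.

(** With [W] of size [t + 2], this is Frankl's non-trivial [t]-intersecting family. *)
Definition clique_family (n k t : nat) (W : {set 'I_n}) : {set {set 'I_n}} :=
  [set A in ksubsets n k | t + 1 <= #|A :&: W|].

Definition petals (n : nat) (T X : {set 'I_n}) : {set {set 'I_n}} :=
  [set x |: T | x in X].

(** The Hilton-Milner type family with kernel [T]. When [T] and [X] are disjoint of sizes [t] and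
    [k - t + 1], deleting a point of [T] from their union leaves a [k]-set. *)
Definition flower_family (n k : nat) (T X : {set 'I_n}) : {set {set 'I_n}} :=
  upset k (petals T X) :|: [set (T :|: X) :\ i | i in T].

Section Structure.
Variables (n k t : nat) (G : {set {set 'I_n}}).
Hypotheses (t0 : 0 < t) (tk : t < k) (tn : t <= n).
Hypothesis Gk : G \subset ksubsets n k.
Hypothesis GI : {in G &, forall A B : {set 'I_n}, t <= #|A :&: B|}.
Hypothesis Gnontriv :
  forall T : {set 'I_n}, #|T| = t -> exists2 A, A \in G & ~~ (T \subset A).

(** The threshold [k] allows a member through a heavy set to avoid a whole other member, or another
    heavy set, outside that heavy set. *)
Let BB := heavy k k t.+1 G.

Let card_G (A : {set 'I_n}) : A \in G -> #|A| = k.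
Proof. by move=> /(subsetP Gk); rewrite inE => /eqP. Qed.

Let card_BB (B : {set 'I_n}) : B \in BB -> #|B| = t.+1.
Proof. by case/heavyP. Qed.

(** Some member through [B] meets [A] only inside [B], and it meets [A] in at least [t] points. *)
Lemma heavy_meets_member (A B : {set 'I_n}) : A \in G -> B \in BB -> t <= #|A :&: B|.
Proof.
move=> AG BH; have [||A' [A'G BA' A'A]] := @heavy_avoid n k k G B A Gk.
- by rewrite (card_BB BH).
- by rewrite card_G.
apply: leq_trans (GI A'G AG) (subset_leq_card _).
by rewrite subsetI subsetIr.
Qed.

Lemma heavy_meets_heavy (B B' : {set 'I_n}) : B \in BB -> B' \in BB -> t <= #|B :&: B'|.
Proof.
move=> BH B'H; have [||A [AG BA AB]] := @heavy_avoid n k k G B B' Gk.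
- by rewrite (card_BB BH).
- by rewrite (card_BB B'H).
apply: leq_trans (heavy_meets_member AG B'H) (subset_leq_card _).
by rewrite subsetI AB subsetIr.
Qed.

Lemma member_ex : exists A, A \in G.
Proof.
have [|T _ /Gnontriv[A]] := @exists_subset_card _ t [set: 'I_n].
  by rewrite cardsT card_ord.
by exists A.
Qed.

(** Branching: a member contains a [t]-subset [T] of a fixed [A0], and also a point outside [T] of
    some member not containing [T]. So at most ['C(k, t) * k] sets of size [t + 1] cover [G], and
    the non-heavy ones contribute only to the error term. *)
Lemma card_le_heavy :
  #|G| <= #|BB| * deg n k t.+1 + 'C(k, t) * k * (k * deg n k t.+2).
Proof.
have [A0 A0G] := member_ex.
pose f (T : {set 'I_n}) := odflt set0 [pick A in G | ~~ (T \subset A)].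
have fP (T : {set 'I_n}) : #|T| = t -> f T \in G /\ ~~ (T \subset f T).
  move=> /Gnontriv[A AG TA]; rewrite /f; case: pickP => [B /andP[]|/(_ A)] //.
  by rewrite /= AG TA.
pose D := \bigcup_(T in [set T : {set 'I_n} | T \subset A0 & #|T| == t]) petals T (f T :\: T).
rewrite -(cardsID (upset k BB) G) leq_add //.
  apply: leq_trans (subset_leq_card (subsetIr _ _)) _.
  by apply: card_upset_le => B /card_BB ->.
apply: leq_trans (@card_covered_le _ _ (D :\: BB) (k * deg n k t.+2) _ _) _.
- move=> A /setDP[AG AB].
  have [T] := exists_subset_card (GI AG A0G); rewrite subsetI => /andP[TA TA0] Tt.
  have [fG Tf] := fP T Tt.
  (* Otherwise [A] and [f T] meet inside [T], hence by size exactly in [T], and [f T] would contain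
     [T]. *)
  have /subsetPn[x /setIP[xA xf] xT] : ~~ (A :&: f T \subset T).
    apply: contra Tf => AfT; apply: subset_trans (subsetIr A _).
    suff /eqP -> : A :&: f T == T by [].
    by rewrite eqEcard AfT Tt GI.
  have xTA : x |: T \subset A by rewrite subUset sub1set xA.
  exists (x |: T) => //; rewrite inE; apply/andP; split.
    apply: contra AB => xTB; apply/upsetP; split; first exact: card_G.
    by exists (x |: T).
  apply/bigcupP; exists T; first by rewrite inE TA0 Tt eqxx.
  by apply: imset_f; rewrite inE xT.
- move=> B /setDP[/bigcupP[T]]; rewrite inE => /andP[_ /eqP Tt].
  case/imsetP => x /setDP[_ xT] -> nB; rewrite leqNgt; apply: contra nB => lt.
  apply/heavyP; split; first by rewrite cardsU1 xT Tt.
  apply: leq_trans lt (subset_leq_card _); apply/subsetP => A.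
  by rewrite !inE => /andP[/andP[_ ->]].
rewrite leq_mul2r; apply/orP; right.
apply: leq_trans (subset_leq_card (subsetDl _ _)) _.
apply: leq_trans (card_bigcup_le (b := k) _) _.
  move=> T; rewrite inE => /andP[_ /eqP Tt]; have [fG _] := fP T Tt.
  apply: leq_trans (leq_imset_card _ _) _; rewrite -(card_G fG).
  exact/subset_leq_card/subsetDl.
by rewrite cards_draws card_G.
Qed.

(** [m] is the number of heavy sets needed to match the leading coefficient of a core. With fewer
    the first bound holds; with at least [m] they determine the shape of [G]. *)
Lemma intersecting_structure (m := maxn t.+2 (k - t + 1)) :
  [\/ #|G| <= m.-1 * deg n k t.+1 + 'C(k, t) * k * (k * deg n k t.+2),
      k <= 2 * t + 1 /\ exists2 W : {set 'I_n}, #|W| = t.+2 & G \subset clique_family k t W |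
      2 * t + 1 <= k /\ exists T X : {set 'I_n}, [/\ #|T| = t, #|X| = k - t + 1, [disjoint T & X] &
                                        G \subset flower_family k T X]].
Proof.
have [mB|Bm] := leqP m #|BB|; last first.
  apply: Or31; apply: leq_trans card_le_heavy _.
  by rewrite leq_add2r leq_mul2r; apply/orP; right; lia.
have [|[T Tt TB]|[W Wt WB]] := sunflower_or_clique card_BB heavy_meets_heavy.
- lia.
- apply: Or33.
  pose X := [set x | (x \notin T) && (x |: T \in BB)].
  have mX : m <= #|X|.
    apply: leq_trans mB (leq_trans (subset_leq_card _) (leq_imset_card (fun x => x |: T) X)).
    apply/subsetP => B BH; have := cardsDS (TB B BH); rewrite Tt (card_BB BH) subSnn.
    move/eqP/cards1P => [x xE].
    have xTB : x |: T = B by rewrite -xE setUC setDE setUIr setUCr setIT (setUidPr (TB _ BH)).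
    apply/imsetP; exists x => //.
    have /setDP[xB xT] : x \in B :\: T by rewrite xE set11.
    by rewrite in_set xT xTB.
  (* A member missing part of the kernel has at most [t - 1] points there, so it must contain every
     petal point. These already number at least [k - t + 1], which leaves no room for anything
     else. *)
  have key (A : {set 'I_n}) : A \in G -> ~~ (T \subset A) -> A :\: T = X /\ #|X| = k - t + 1.
    move=> AG TA.
    have AT : #|A :&: T| < t.
      by rewrite -Tt; apply: proper_card; rewrite properE subsetIr subsetI subxx andbT.
    have XA : X \subset A :\: T.
      apply/subsetP => x; rewrite in_set in_setD => /andP[-> xB] /=; apply/negPn/negP => xA.
      suff h : A :&: (x |: T) \subset A :&: T.
        have := leq_trans (heavy_meets_member AG xB) (subset_leq_card h).
        by rewrite leqNgt AT.
      apply/subsetP => y.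
      rewrite !inE => /andP[yA /orP[/eqP yx|->]]; last by rewrite yA.
      by rewrite -yx yA in xA.
    have AT' : t.-1 <= #|A :&: T|.
      have /card_gt0P[x] : 0 < #|X| by lia.
      rewrite in_set => /andP[xT /(heavy_meets_member AG)].
      rewrite setIUr => h; have := leq_trans h (leq_card_setU _ _).
      have := subset_leq_card (subsetIr A [set x]); rewrite cards1; lia.
    have c : #|A :\: T| = k - t + 1 by rewrite cardsD (card_G AG); lia.
    have e : X = A :\: T.
      by apply/eqP; rewrite eqEcard XA c; apply: leq_trans (leq_maxr _ _) mX.
    by rewrite -e in c *.
  have [A1 A1G TA1] := Gnontriv Tt.
  have [A1X Xc] := key A1 A1G TA1.
  split; first by lia.
  exists T, X; split=> //.
    by rewrite disjoint_sym disjoints_subset; apply/subsetP => x; rewrite in_setC in_set => /andP[].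
  apply/subsetP => A AG; apply/setUP; have [TA|TA] := boolP (T \subset A).
    left; have /subsetPn[x /setIP[xA xA1] xT] : ~~ (A :&: A1 \subset T).
      apply: contra TA1 => AT; apply: subset_trans (subsetIr A _).
      suff /eqP -> : A :&: A1 == T by [].
      by rewrite eqEcard AT Tt GI.
    apply/upsetP; split; first exact: card_G.
    exists (x |: T); last by rewrite subUset sub1set xA.
    by apply: imset_f; rewrite -A1X inE xT.
  right; have [AX _] := key A AG TA; have /subsetPn[i iT iA] := TA.
  apply/imsetP; exists i => //; apply/eqP; rewrite eqEcard; apply/andP; split.
    apply/subsetP => y yA; rewrite in_setD1 in_setU -AX in_setD yA andbT orbN andbT.
    by apply: contraNneq iA => <-.
  have := cardsD1 i (T :|: X); rewrite in_setU iT /= (card_G AG) => e.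
  have := leq_card_setU T X; rewrite Tt Xc e => -[h _]; lia.
apply: Or32.
(* [W] has only [t + 2] subsets of size [t + 1], so all of them are heavy, and [m <= t + 2] gives
   the bound on [k]. *)
have BBE : BB = [set B : {set 'I_n} | B \subset W & #|B| == t.+1].
  apply/eqP; rewrite eqEcard cards_draws Wt binSn; apply/andP; split; last by lia.
  by apply/subsetP => B BH; rewrite inE WB // card_BB // eqxx.
split.
  move: mB; rewrite BBE cards_draws Wt binSn; lia.
exists W => //; apply/subsetP => A AG; rewrite inE (subsetP Gk) //= leqNgt; apply/negP => AW.
have inBB a : a \in W -> W :\ a \in BB.
  by move=> aW; rewrite BBE inE subD1set /=; have := cardsD1 a W; rewrite aW Wt /= add1n => -[<-].
have /card_gt0P[B BH] : 0 < #|BB| by lia.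
have h := leq_trans (heavy_meets_member AG BH) (subset_leq_card (setIS A (WB B BH))).
(* If [A] had at most [t] points in [W], deleting one of them from [W] would leave a heavy set
   meeting [A] in fewer than [t] points. *)
have /card_gt0P[a /setIP[aA aW]] : 0 < #|A :&: W| by lia.
have := heavy_meets_member AG (inBB a aW); rewrite setIDA.
have := cardsD1 a (A :&: W); rewrite inE aA aW /= add1n; lia.
Qed.

End Structure.

(** * Flowers against cliques, and permutations of the ground set *)

Lemma card_fibers_le (I J : finType) (g : I -> J) (P Q : {set I}) :
  (forall j, #|[set x in P | g x == j]| <= #|[set x in Q | g x == j]|) -> #|P| <= #|Q|.
Proof.
move=> h; rewrite -!sum1_card (partition_big g xpredT) //=.
rewrite [leqRHS](partition_big g xpredT) //=; apply: leq_sum => j _.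
by have := h j; rewrite -!sum1_card; congr (_ <= _); apply: eq_bigl => x; rewrite inE.
Qed.

Definition block (I : finType) (X T R : {set I}) a b : {set {set I}} :=
  [set A : {set I} | [&& A :\: (T :|: X) == R, #|A :&: X| == a & #|A :&: T| == b]].

Lemma card_block (I : finType) (X T R : {set I}) a b :
  [disjoint T & X] -> [disjoint R & T :|: X] ->
  #|block X T R a b| = 'C(#|X|, a) * 'C(#|T|, b).
Proof.
move=> dTX dR.
have TX x : (x \in T) ==> (x \notin X) by apply/implyP => xT; rewrite (disjointFr dTX).
have RTX x : (x \in R) ==> (x \notin T :|: X) by apply/implyP => xR; rewrite (disjointFr dR).
rewrite -!cards_draws -cardsX.
pose f (p : {set I} * {set I}) := p.1 :|: p.2 :|: R.
have fE (P Q : {set I}) : P \subset X -> Q \subset T ->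
    [/\ f (P, Q) :&: X = P, f (P, Q) :&: T = Q & f (P, Q) :\: (T :|: X) = R].
  move=> /subsetP PX /subsetP QT; split; apply/setP => x;
  have := TX x; have := RTX x; have /implyP := PX x; have /implyP := QT x; rewrite !inE /=;
  by case: (x \in P); case: (x \in Q); case: (x \in R); case: (x \in T); case: (x \in X).
rewrite -(@card_in_imset _ _ f); last first.
  move=> [P Q] [P' Q']; rewrite !inE /= => /andP[/andP[PX _] /andP[QT _]].
  case/andP => /andP[P'X _] /andP[Q'T _] e.
  have [eX eT _] := fE P Q PX QT; have [eX' eT' _] := fE P' Q' P'X Q'T.
  by congr (_, _); [rewrite -eX e eX' | rewrite -eT e eT'].
apply: eq_card => A; rewrite inE; apply/idP/imsetP.
  case/and3P => /eqP AR /eqP Aa /eqP Ab; exists (A :&: X, A :&: T).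
    by rewrite !inE /= !subsetIr Aa Ab !eqxx.
  rewrite /f /= -AR; apply/setP => x; rewrite !inE.
  by case: (x \in A); case: (x \in T); case: (x \in X).
case=> [[P Q]]; rewrite !inE /= => /andP[/andP[PX /eqP <-] /andP[QT /eqP <-]] ->.
by have [-> -> ->] := fE P Q PX QT; rewrite !eqxx.
Qed.

(** Applying Pascal's rule twice on the left reduces the claim to [h]. The two sides count the
    members of a flower and of a clique with a common trace outside [T :|: X]. *)
Lemma bin_flower_le t j : j <= t ->
  'C(t.+2, j.+1) + (j == t) * t <= t.+2 * 'C(t, j) + (if j is j'.+1 then 'C(t, j') else 0).
Proof.
move=> jt; have h : 'C(t, j.+1) + (j == t) * t <= t * 'C(t, j).
  case: eqP => [->|_]; first by rewrite binn bin_small // mul1n muln1.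
  rewrite mul0n addn0; apply: leq_trans (_ : j.+1 * 'C(t, j.+1) <= _); first by rewrite leq_pmull.
  by rewrite mul_bin_left leq_mul2r leq_subr orbT.
rewrite !binS; case: j {jt} h => [|j]; rewrite ?bin0; first by lia.
rewrite binS => h; lia.
Qed.

(** At [k = 2 * t + 1] the set [X] has size [t + 2] and carries a clique itself. The families are
    compared for each fixed trace [R] outside [T :|: X]; removing [upset k S] is harmless, as it
    depends on [R] only. *)
Lemma flower_le_clique n t (T X : {set 'I_n}) (S : {set {set 'I_n}})
    (k := 2 * t + 1) :
  0 < t -> #|T| = t -> #|X| = t.+2 -> [disjoint T & X] ->
  {in S, forall U : {set 'I_n}, [disjoint U & T :|: X]} ->
  #|flower_family k T X :\: upset k S| <= #|clique_family k t X :\: upset k S|.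
Proof.
move=> t0 Tt Xt dTX SY; apply: (card_fibers_le (g := fun A : {set 'I_n} => A :\: (T :|: X))) => R.
set L := [set _ in _ | _]; set RHS := [set _ in clique_family _ _ _ :\: _ | _].
have [->|[A0 A0L]] := set_0Vmem L; first by rewrite cards0.
have cA (A : {set _}) : #|A| = #|A :&: T| + #|A :&: X| + #|A :\: (T :|: X)|.
  rewrite -(cardsID (T :|: X) A) setIUr cardsU -setIIr.
  by rewrite (disjoint_setI0 dTX) setI0 cards0 subn0.
have FL (A : {set _}) : A \in flower_family k T X -> #|A| = k /\
    ((T \subset A /\ 0 < #|A :&: X|) \/ exists2 i, i \in T & A = (T :|: X) :\ i).
  case/setUP => [/upsetP[Ak [B /imsetP[x xX ->]]]|/imsetP[i iT ->]].
    rewrite subUset sub1set => /andP[xA TA]; split=> //; left; split=> //.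
    by apply/card_gt0P; exists x; rewrite inE xA.
  split; last by right; exists i.
  have := cardsD1 i (T :|: X); rewrite inE iT cardsU Tt Xt (disjoint_setI0 dTX) cards0 /= add1n.
  by rewrite /k; lia.
have dR : [disjoint R & T :|: X].
  move: A0L; rewrite inE => /andP[_ /eqP <-].
  by rewrite disjoints_subset; apply/subsetP => x; rewrite !inE => /andP[].
(* [R \in upset #|R| S] merely expresses that [R] contains a set of [S]. *)
have RS (A : {set _}) : A :\: (T :|: X) = R -> #|A| = k -> (A \in upset k S) = (R \in upset #|R| S).
  move=> AR Ak; apply/upsetP/upsetP => [[_ [U US UA]]|[_ [U US UR]]]; split=> //; exists U => //.
    by rewrite -AR subsetD UA SY.
  by rewrite -AR in UR; apply: subset_trans UR (subsetDl _ _).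
have R_S : R \notin upset #|R| S.
  move: A0L; rewrite inE => /andP[/setDP[/FL[A0k _] A0S] /eqP A0R].
  by rewrite -(RS A0).
have Rt : #|R| <= t.
  move: A0L; rewrite inE => /andP[/setDP[/FL[A0k A0F] _] /eqP A0R].
  case: A0F => [[TA X0]|[i iT A0E]].
    by have := cA A0; rewrite A0k A0R (setIidPr TA) Tt /k; lia.
  by rewrite -A0R A0E (_ : _ :\: _ = set0) ?cards0 //; apply/eqP; rewrite setD_eq0 subD1set.
have [j jE] : exists j, j = t - #|R| by exists (t - #|R|).
(* A flower member through [T] has [j + 1] points in [X]. The [t] exceptional sets have empty trace,
   so they occur only for [j = t]. *)
have L_le : #|L| <= 'C(t.+2, j.+1) + (j == t) * t.
  apply: leq_trans (_ : #|block X T R j.+1 t :|: (if j == t then block X T R t.+2 t.-1 else set0)| <= _).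
    apply: subset_leq_card; apply/subsetP => A; rewrite inE => /andP[/setDP[/FL[Ak AF] _] /eqP AR].
    rewrite inE; case: AF => [[TA X0]|[i iT AE]].
      rewrite inE AR (setIidPr TA) Tt !eqxx andbT /=; apply/orP; left.
      have := cA A; rewrite Ak AR (setIidPr TA) Tt /k jE.
      by move: Rt; move: #|R| #|A :&: X| => r a; lia.
    have R0 : R = set0 by apply/eqP; rewrite -AR setD_eq0 AE subD1set.
    rewrite {2}jE R0 cards0 subn0 eqxx; apply/orP; right.
    have XA : A :&: X = X.
      apply/setIidPr; rewrite AE; apply/subsetP => x xX; rewrite !inE xX orbT andbT.
      by apply: contraTneq xX => ->; rewrite (disjointFr dTX).
    have := cA A; rewrite inE AR R0 XA Ak Xt cards0 !eqxx /= /k; lia.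
  apply: leq_trans (leq_card_setU _ _) _; rewrite card_block // Tt Xt binn muln1 leq_add2l.
  case: eqP => [jt|_]; last by rewrite cards0.
  by rewrite card_block // Tt Xt binn mul1n mul1n; case: (t) t0 => // t' _; rewrite [_.+1.-1]/= binSn.
apply: leq_trans L_le (leq_trans (bin_flower_le _) _); first by rewrite jE leq_subr.
(* Clique members have [t + 1] or [t + 2] points in [X], leaving [j] or [j - 1] for [T]; the second
   block is absent for [j = 0]. *)
have bR a b : a + b = t.+1 + j -> t < a -> block X T R a b \subset RHS.
  move=> ab ta; apply/subsetP => A; rewrite inE => /and3P[/eqP AR /eqP Aa /eqP Ab].
  have Ak : #|A| = k by rewrite cA Aa Ab AR /k; rewrite jE in ab; lia.
  by rewrite inE in_setD (RS A AR Ak) R_S AR eqxx andbT inE ksubsetsE Ak Aa addn1 ta eqxx.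
case: (posnP j) => [j0|j0].
  have /subset_leq_card : block X T R t.+1 0 \subset RHS by apply: bR; rewrite ?j0.
  by rewrite card_block // Tt Xt binSn j0 addn0 bin0.
have -> : (if j is j'.+1 then 'C(t, j') else 0) = 'C(t, j.-1) by case: (j) j0.
apply: leq_trans (_ : #|block X T R t.+1 j :|: block X T R t.+2 j.-1| <= _); last first.
  by apply: subset_leq_card; rewrite subUset !bR //; lia.
rewrite cardsU !card_block // Tt Xt binSn binn mul1n.
rewrite (_ : _ :&: _ = set0) ?cards0 ?subn0 //.
apply/setP => A; rewrite !inE; apply/negP => /andP[/and3P[_ /eqP -> _] /and3P[_ /eqP]]; lia.
Qed.

Lemma perm_of_classes n p (f g : 'I_n -> 'I_p.+1) :
  (forall i : 'I_p, #|[set x | f x == widen_ord (leqnSn p) i]| =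
                    #|[set x | g x == widen_ord (leqnSn p) i]|) ->
  exists s : {perm 'I_n}, forall x, g (s x) = f x.
Proof.
move=> h.
have tot (e : 'I_n -> 'I_p.+1) : \sum_(i < p.+1) #|[set x | e x == i]| = n.
  rewrite -[RHS]card_ord -sum1_card (partition_big e xpredT) //=.
  by apply: eq_bigr => i _; rewrite -sum1_card; apply: eq_bigl => x; rewrite inE.
(* The last colour class takes all remaining points, so its size is forced. *)
have {}h i : #|[set x | f x == i]| = #|[set x | g x == i]|.
  have := etrans (tot f) (esym (tot g)); rewrite !big_ord_recr /=.
  rewrite (eq_bigr _ (fun i _ => h i)) => /addnI e.
  have [ip|pi] := ltnP i p; last first.
    by rewrite (_ : i = ord_max) //; apply/val_inj/anti_leq; rewrite /= pi -ltnS ltn_ord.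
  by rewrite (_ : i = widen_ord (leqnSn p) (Ordinal ip)) ?h //; apply: val_inj.
have : perm_eq (mktuple f) (mktuple g).
  have c (e : 'I_n -> 'I_p.+1) i : count_mem i (mktuple e) = #|[set x | e x == i]|.
    rewrite -[tval _]/(map e (enum 'I_n)) count_map cardsE cardE /enum_mem size_filter.
    by rewrite filter_predT; apply: eq_count => x; rewrite !inE.
  by apply/allP => i _; apply/eqP; rewrite !c.
case/tuple_permP => s /val_inj sE; exists s => x.
by have := tnth_mktuple f x; rewrite sE !tnth_mktuple.
Qed.

Lemma perm_of_disjoint_lists n (L L' : seq {set 'I_n}) :
  size L = size L' ->
  pairwise (fun A B : {set 'I_n} => [disjoint A & B]) L ->
  pairwise (fun A B : {set 'I_n} => [disjoint A & B]) L' ->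
  (forall j, #|nth set0 L j| = #|nth set0 L' j|) ->
  exists s : {perm 'I_n}, forall j, s @: nth set0 L j = nth set0 L' j.
Proof.
move=> sL dL dL' cL.
(* A point gets the index of the first set containing it; points in no set share the extra colour
   [size L]. *)
pose col (M : seq {set 'I_n}) x := inord (find (fun A : {set 'I_n} => x \in A) M) : 'I_(size L).+1.
have colE (M : seq {set 'I_n}) : size M = size L ->
    pairwise (fun A B : {set 'I_n} => [disjoint A & B]) M ->
    forall (j : 'I_(size L)) x, (col M x == widen_ord (leqnSn _) j) = (x \in nth set0 M j).
  move=> sM dM j x; have jM : j < size M by rewrite sM.
  rewrite -val_eqE /= inordK; last by rewrite ltnS -sM find_size.
  apply/eqP/idP => [fj|xj].
    by have := @nth_find _ set0 (fun A : {set 'I_n} => x \in A) M; rewrite has_find fj; exact.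
  have hx : has (fun A : {set 'I_n} => x \in A) M by apply/(has_nthP set0); exists j.
  have := nth_find set0 hx; rewrite has_find in hx.
  set i := find _ _ in hx * => xi; apply/eqP; rewrite eqn_leq; apply/andP; split.
    rewrite leqNgt; apply/negP => ji; by have := before_find set0 ji; rewrite xj.
  rewrite leqNgt; apply/negP => ij.
  have := (pairwiseP set0 dM) i j hx jM ij => /disjointFr /(_ xi).
  by rewrite xj.
have [s sE] : exists s : {perm 'I_n}, forall x, col L' (s x) = col L x.
  apply: perm_of_classes => i; have := cL i.
  by congr (_ = _); apply: eq_card => x; rewrite inE colE.
exists s => j; have [jL|Lj] := ltnP j (size L); last first.
  by rewrite !nth_default -?sL // imset0.
apply/setP => y; rewrite -[y](permKV s) (mem_imset _ _ perm_inj).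
by rewrite -(colE L _ _ (Ordinal jL)) // -(colE L' _ _ (Ordinal jL)) // sE.
Qed.

Lemma exists_perm_config n t (D D' : {set {set 'I_n}}) (T X T' X' : {set 'I_n}) :
  trivIset D -> trivIset D' -> #|D| = #|D'| ->
  {in D, forall A : {set 'I_n}, #|A| = t} -> {in D', forall A : {set 'I_n}, #|A| = t} ->
  [disjoint T & X] -> [disjoint T' & X'] -> #|T| = #|T'| -> #|X| = #|X'| ->
  {in D, forall A : {set 'I_n}, [disjoint A & T :|: X]} ->
  {in D', forall A : {set 'I_n}, [disjoint A & T' :|: X']} ->
  exists s : {perm 'I_n}, [/\ s @: T = T', s @: X = X' &
    {in D, forall A : {set 'I_n}, s @: A \in D'}].
Proof.
move=> tD tD' cD Dt Dt' dTX dTX' cT cX DTX DTX'.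
have pw (E : {set {set 'I_n}}) (U Y : {set 'I_n}) : trivIset E -> [disjoint U & Y] ->
    {in E, forall A : {set 'I_n}, [disjoint A & U :|: Y]} ->
    pairwise (fun A B : {set 'I_n} => [disjoint A & B]) (U :: Y :: enum E).
  move=> /trivIsetP tE dUY EUY /=; rewrite dUY /=.
  have h A : A \in enum E -> [disjoint U & A] /\ [disjoint Y & A].
    rewrite mem_enum => /EUY; rewrite disjoint_sym !disjoints_subset subUset.
    by case/andP.
  apply/and3P; split; try by apply/allP => A /h[].
  apply: (sub_in_pairwise (P := mem E) (r := fun A B => A != B)).
  - by move=> A B AE BE; exact: tE.
  - by apply/allP => A; rewrite mem_enum.
  - by rewrite -uniq_pairwise enum_uniq.
have sE : size (enum D) = size (enum D') by rewrite -!cardE.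
have [||||s sL] := @perm_of_disjoint_lists n (T :: X :: enum D) (T' :: X' :: enum D').
- by rewrite /= sE.
- exact: pw.
- exact: pw.
- case=> [|[|j]] //=; have [jD|Dj] := ltnP j (size (enum D)).
    by rewrite Dt ?Dt' // -mem_enum mem_nth -?sE.
  by rewrite !nth_default -?sE.
exists s; split; [exact: (sL 0) | exact: (sL 1) |] => A AD.
have jD : index A (enum D) < size (enum D) by rewrite index_mem mem_enum.
have := sL (index A (enum D)).+2; rewrite /= nth_index ?mem_enum // => ->.
by rewrite -mem_enum mem_nth -?sE.
Qed.

(** * Comparison with the extremal family *)

(** The set index is the support of the core. The parameter [b] settles the boundary
    [k = 2 * t + 1]: both shapes are allowed there for [b = 1], only the clique for [b = 2]. *)
Inductive core (n k t b : nat) : {set 'I_n} -> {set {set 'I_n}} -> Prop :=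
| CliqueCore (W : {set 'I_n}) of k <= 2 * t + 1 & #|W| = t.+2 : core k t b W (clique_family k t W)
| FlowerCore (T X : {set 'I_n}) of 2 * t + b <= k & #|T| = t & #|X| = k - t + 1 & [disjoint T & X] :
    core k t b (T :|: X) (flower_family k T X).

Lemma clique_familyE n k t (W : {set 'I_n}) :
  clique_family k t W = upset k [set B : {set 'I_n} | B \subset W & #|B| == t.+1].
Proof.
apply/setP => A; rewrite inE ksubsetsE addn1; apply/andP/upsetP => [[/eqP Ak tA]|[Ak [B]]].
  split=> //; have [B] := exists_subset_card tA; rewrite subsetI => /andP[BA BW] Bt.
  by exists B; rewrite // inE BW Bt eqxx.
rewrite inE => /andP[BW /eqP <-] BA; split; first by apply/eqP.
by apply: subset_leq_card; rewrite subsetI BA.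
Qed.

(** A common presentation of both shapes: [m] generators of size [t + 1] covering the support, and
    exceptional sets inside it. The range of [k] decides which argument of the maximum [m] is
    attained. *)
Lemma core_generators n k t b (Y : {set 'I_n}) (C : {set {set 'I_n}})
    (m := maxn t.+2 (k - t + 1)) :
  0 < t -> 0 < b -> core k t b Y C ->
  exists BB E : {set {set 'I_n}}, [/\ C = upset k BB :|: E, #|BB| = m,
    {in BB, forall B : {set 'I_n}, #|B| = t.+1 /\ B \subset Y},
    {in Y, forall y, exists2 B, B \in BB & y \in B} &
    {in E, forall A : {set 'I_n}, A \subset Y}].
Proof.
move=> t0 b0; case=> [W kt Wt|T X kt Tt Xk dTX].
  exists [set B : {set 'I_n} | B \subset W & #|B| == t.+1], set0; split.
  - by rewrite setU0 clique_familyE.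
  - by rewrite cards_draws Wt binSn /m; lia.
  - by move=> B; rewrite inE => /andP[BW /eqP].
  - move=> y yW; have : 0 < #|W :\ y| by have := cardsD1 y W; rewrite yW Wt; lia.
    case/card_gt0P => z /setD1P[zy zW]; exists (W :\ z); last by rewrite !inE eq_sym zy.
    by rewrite inE subD1set; have := cardsD1 z W; rewrite zW Wt /= add1n => -[<-].
  - by move=> A; rewrite inE.
exists (petals T X), [set (T :|: X) :\ i | i in T]; split=> //.
- rewrite card_in_imset ?Xk ?/m; first by lia.
  move=> x y xX yX /setP/(_ x); rewrite !inE eqxx (disjointFl dTX xX) /=.
  by move/esym/orP=> [/eqP|].
- move=> _ /imsetP[x xX ->]; rewrite cardsU1 (disjointFl dTX xX) Tt; split=> //.
  by rewrite subUset subsetUl sub1set inE xX orbT.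
- move=> y /setUP[yT|yX]; last by exists (y |: T); [exact: imset_f | rewrite setU11].
  have /card_gt0P[x xX] : 0 < #|X| by lia.
  by exists (x |: T); [exact: imset_f | rewrite inE yT orbT].
- by move=> _ /imsetP[i _ ->]; exact: subD1set.
Qed.

Section CoreBounds.
Variables (n k t b K : nat) (Y : {set 'I_n}) (C : {set {set 'I_n}}).
Hypotheses (t0 : 0 < t) (b0 : 0 < b) (K0 : 0 < K) (gapK : gap n k K).
Hypothesis coreC : core k t b Y C.
Let m := maxn t.+2 (k - t + 1).

Lemma core_card_ge : m * deg n k t.+1 <= #|C| + m * m * deg n k t.+2.
Proof.
have [BB [E [-> cBB BBt _ _]]] := core_generators t0 b0 coreC.
have := @card_upset_ge n k t.+1 t.+2 BB; rewrite cBB => h.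
apply: leq_trans (h _ _) _.
- by move=> B /BBt[].
- move=> B B' /BBt[Bt _] /BBt[Bt' _] nBB; apply: (gap_anti gapK K0).
  rewrite -Bt; apply: proper_card; rewrite properE subsetUl /= subUset subxx /=.
  by apply: contra nBB => s; rewrite eq_sym eqEcard s Bt Bt' leqnn.
by rewrite leq_add2r; apply/subset_leq_card/subsetUl.
Qed.

(** A center disjoint from the support spans [2 * t + 1] points with a generator, and no exceptional
    set contains it. *)
Lemma core_upset_le (D : {set {set 'I_n}}) :
  {in D, forall U : {set 'I_n}, #|U| = t /\ [disjoint U & Y]} ->
  #|upset k D :&: C| <= #|D| * m * deg n k (2 * t + 1).
Proof.
move=> DY; have [BB [E [-> cBB BBt _ EY]]] := core_generators t0 b0 coreC.
have -> : upset k D :&: (upset k BB :|: E) = upset k D :&: upset k BB.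
  rewrite setIUr; apply/setUidPl/subsetP => A /setIP[/upsetP[_ [U UD UA]] /EY AY].
  have [Ut UY] := DY U UD; have /card_gt0P[x xU] : 0 < #|U| by rewrite Ut.
  by have := subsetP (subset_trans UA AY) x xU; rewrite (disjointFr UY xU).
rewrite /m -cBB; apply: card_upsetI_le => U B /DY[Ut UY] /BBt[Bt BY].
apply: (gap_anti gapK K0); rewrite cardsU disjoint_setI0 ?cards0; first by lia.
by apply: disjointWr UY.
Qed.

(** A generator through a common point of [U] and [Y] spans at most [2 * t] points with [U]. *)
Lemma core_touch (U : {set 'I_n}) :
  #|U| = t -> ~~ [disjoint U & Y] -> deg n k (2 * t) <= #|C :&: upset k [set U]|.
Proof.
move=> Ut; rewrite -setI_eq0 => /set0Pn[y /setIP[yU yY]].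
have [BB [E [-> cBB BBt BBY EY]]] := core_generators t0 b0 coreC.
have [B BBB yB] := BBY y yY; have [Bt _] := BBt B BBB.
apply: leq_trans (_ : deg n k #|B :|: U| <= _).
  apply: (gap_anti gapK K0); have /card_gt0P : exists x, x \in B :&: U by exists y; rewrite inE yB.
  by rewrite cardsU Bt Ut; lia.
rewrite -card_upset1; apply: subset_leq_card; apply/subsetP => A /upset1P[Ak].
rewrite subUset => /andP[BA UA]; apply/setIP; split; last by apply/upset1P.
by apply/setUP; left; apply/upsetP; split=> //; exists B.
Qed.

End CoreBounds.

Lemma perm_upset n k (s : {perm 'I_n}) (D D' : {set {set 'I_n}}) (A : {set 'I_n}) :
  {in D, forall U : {set 'I_n}, s @: U \in D'} -> A \in upset k D -> s @: A \in upset k D'.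
Proof.
move=> sD /upsetP[Ak [U UD UA]]; apply/upsetP; split; first by rewrite card_imset //; exact: perm_inj.
by exists (s @: U); [exact: sD | exact: imsetS].
Qed.

Lemma perm_card_le n (s : {perm 'I_n}) (P Q : {set {set 'I_n}}) :
  {in P, forall A : {set 'I_n}, s @: A \in Q} -> #|P| <= #|Q|.
Proof.
move=> h; rewrite -(card_imset (mem P) (imset_inj (@perm_inj _ s))).
by apply: subset_leq_card; apply/subsetP => _ /imsetP[A AP ->]; exact: h.
Qed.

(* The target is a core with [b = 2], so that it is a clique when [k = 2 t + 1],
   where both kinds of core are available for the source. *)
Lemma core_union_le n k t (Y Y' : {set 'I_n}) (C C' D D' : {set {set 'I_n}}) :
  0 < t -> core k t 1 Y C -> core k t 2 Y' C' ->
  trivIset D -> trivIset D' -> #|D| = #|D'| ->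
  {in D, forall U : {set 'I_n}, #|U| = t /\ [disjoint U & Y]} ->
  {in D', forall U : {set 'I_n}, #|U| = t /\ [disjoint U & Y']} ->
  #|upset k D :|: C| <= #|upset k D' :|: C'|.
Proof.
move=> t0 coreC coreC' tD tD' cD DY D'Y'.
have Dt (U : {set 'I_n}) : U \in D -> #|U| = t by case/DY.
have D't (U : {set 'I_n}) : U \in D' -> #|U| = t by case/D'Y'.
have perm_clique (W W' : {set 'I_n}) : #|W| = t.+2 -> #|W'| = t.+2 ->
    {in D, forall U : {set 'I_n}, [disjoint U & W]} ->
    {in D', forall U : {set 'I_n}, [disjoint U & W']} ->
    #|upset k D :|: clique_family k t W| <= #|upset k D' :|: clique_family k t W'|.
  move=> Wt Wt' DW DW'.
  have [||||||s [_ sW sD]] := @exists_perm_config n t D D' set0 W set0 W' tD tD' cD Dt D't.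
  - by rewrite -setI_eq0 set0I.
  - by rewrite -setI_eq0 set0I.
  - by [].
  - by rewrite Wt.
  - by move=> U UD; rewrite set0U; exact: DW.
  - by move=> U UD; rewrite set0U; exact: DW'.
  apply: (@perm_card_le _ s) => A /setUP[|].
    by move=> h; apply/setUP; left; exact: perm_upset h.
  rewrite inE => /andP[]; rewrite ksubsetsE => Ak AW; apply/setUP; right.
  rewrite inE ksubsetsE -sW -imsetI; last by move=> x y _ _; exact: perm_inj.
  by rewrite !card_imset ?Ak //; exact: perm_inj.
case: coreC DY => [W kt Wt|T X kt Tt Xk dTX] DY;
  case: coreC' D'Y' => [W' kt' Wt'|T' X' kt' Tt' Xk' dTX'] D'Y'.
- by apply: perm_clique => // U; [case/DY | case/D'Y'].
- by lia.
(* The boundary case: the flower is first replaced by the clique on its own petal points, and that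
   clique is then permuted onto the target. *)
- have kE : k = 2 * t + 1 by lia.
  have Xt : #|X| = t.+2 by lia.
  have h : #|flower_family k T X :\: upset k D| <= #|clique_family k t X :\: upset k D|.
    by rewrite kE; apply: flower_le_clique => // U /DY[].
  have hU (P Q : {set {set 'I_n}}) : #|P :|: Q| = #|P| + #|Q :\: P|.
    by rewrite cardsU cardsD (setIC Q P) addnBA // subset_leq_card // subsetIr.
  apply: leq_trans (perm_clique X W' Xt Wt' _ _).
  + by rewrite !hU leq_add2l.
  + by move=> U /DY[_]; apply: disjointWr; exact: subsetUr.
  + by move=> U /D'Y'[].
have [||||s [sT sX sD]] := @exists_perm_config n t D D' T X T' X' tD tD' cD Dt D't dTX dTX'.
- by rewrite Tt.
- by rewrite Xk.
- by move=> U /DY[].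
- by move=> U /D'Y'[].
apply: (@perm_card_le _ s) => A /setUP[|/setUP[|/imsetP[i iT ->]]].
- by move=> h; apply/setUP; left; exact: perm_upset h.
- move=> h; apply/setUP; right; apply/setUP; left; apply: perm_upset h => _ /imsetP[x xX ->].
  by rewrite imsetU1 sT; apply: imset_f; rewrite -sX; exact: imset_f.
apply/setUP; right; apply/setUP; right; apply/imsetP; exists (s i).
  by rewrite -sT; exact: imset_f.
apply/setP => y; rewrite -[y](permKV s) (mem_imset _ _ perm_inj) -sT -sX.
by rewrite !inE !(mem_imset _ _ perm_inj) (inj_eq perm_inj).
Qed.

Lemma upset_union_le n k t (D D' : {set {set 'I_n}}) :
  trivIset D -> trivIset D' -> #|D| = #|D'| ->
  {in D, forall U : {set 'I_n}, #|U| = t} -> {in D', forall U : {set 'I_n}, #|U| = t} ->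
  #|upset k D| <= #|upset k D'|.
Proof.
move=> tD tD' cD Dt D't.
have d0 : [disjoint (set0 : {set 'I_n}) & (set0 : {set 'I_n})] by rewrite -setI_eq0 set0I.
have dU (U : {set 'I_n}) : [disjoint U & set0 :|: set0] by rewrite -setI_eq0 set0U setI0.
have [s [_ _ sD]] := exists_perm_config tD tD' cD Dt D't d0 d0
  erefl erefl (fun U _ => dU U) (fun U _ => dU U).
by apply: (@perm_card_le _ s) => A; exact: perm_upset.
Qed.

Lemma not_trivIset_ex n (D : {set {set 'I_n}}) : ~~ trivIset D ->
  exists U U', [/\ U \in D, U' \in D, U != U' & ~~ [disjoint U & U']].
Proof.
move=> tD; case: (pickP [pred q : {set 'I_n} * {set 'I_n} |
  [&& q.1 \in D, q.2 \in D, q.1 != q.2 & ~~ [disjoint q.1 & q.2]]]) => [[U U'] /and4P[]|h].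
  by exists U, U'.
case/negP: tD; apply/trivIsetP => U U' UD U'D nU; have /= := h (U, U').
by rewrite UD U'D nU /= => /negbFE.
Qed.

Section Comparison.
Variables (n k t K : nat) (D D' C' G : {set {set 'I_n}}) (Y' : {set 'I_n}).
Let m := maxn t.+2 (k - t + 1).
Let p := #|D'|.
Hypotheses (t0 : 0 < t) (tk : t < k) (tn : t <= n).
Hypothesis gapK : gap n k K.
Hypothesis K_large : 'C(k, t) * k * k + (m + p) * (m + p) <= K.
Hypothesis coreC' : core k t 2 Y' C'.
Hypotheses (tD' : trivIset D') (cD : #|D| = #|D'|).
Hypothesis Dt : {in D, forall U : {set 'I_n}, #|U| = t}.
Hypothesis D'Y' : {in D', forall U : {set 'I_n}, #|U| = t /\ [disjoint U & Y']}.

Let K0 : 0 < K.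
Proof. by apply: (leq_trans _ K_large); rewrite addn_gt0 (muln_gt0 (m + p)) addn_gt0 leq_max !orbT. Qed.

Let D't : {in D', forall U : {set 'I_n}, #|U| = t}.
Proof. by move=> U /D'Y'[]. Qed.

Let delta := p * m * deg n k (2 * t + 1).

Lemma disjoint_upset_ge : p * deg n k t <= #|upset k D'| + p * p * deg n k (2 * t).
Proof.
apply: card_upset_ge => // U U' UD UD' nU.
have := trivIsetP tD' U U' UD UD' nU => dU.
by rewrite cardsU (disjoint_setI0 dU) cards0 subn0 !D't // addnn mul2n.
Qed.

(** Pairwise disjoint centers are permuted onto [D']. Otherwise an intersecting pair spans at most
    [2 * t - 1] points, and its loss exceeds the total overlap [p * p * deg n k (2 * t)] allowed in
    [D']. *)
Lemma centers_le : #|upset k D| <= #|upset k D'|.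
Proof.
have [tD|/not_trivIset_ex[U [U' [UD U'D nU dU]]]] := boolP (trivIset D).
  exact: upset_union_le Dt D't.
have h1 := card_upset_pair k Dt UD U'D nU.
have h2 := disjoint_upset_ge; rewrite cD -/p in h1.
have h3 : (p * p) * deg n k (2 * t) <= deg n k #|U :|: U'|.
  apply: gap_le gapK _ K0 _; first by nia.
  rewrite cardsU (Dt UD) (Dt U'D); have : 0 < #|U :&: U'| by rewrite card_gt0 setI_eq0.
  lia.
rewrite -(leq_add2r (p * p * deg n k (2 * t))); apply: (leq_trans _ (leq_trans h1 h2)).
by rewrite leq_add2l.
Qed.

Lemma centers_lt : ~~ trivIset D -> #|upset k D| + delta <= #|upset k D'|.
Proof.
case/not_trivIset_ex => [U [U' [UD U'D nU dU]]].
have h1 := card_upset_pair k Dt UD U'D nU.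
have h2 := disjoint_upset_ge; rewrite cD -/p in h1.
have h3 : (p * p + p * m) * deg n k (2 * t) <= deg n k #|U :|: U'|.
  apply: gap_le gapK _ K0 _; first by nia.
  rewrite cardsU (Dt UD) (Dt U'D); have : 0 < #|U :&: U'| by rewrite card_gt0 setI_eq0.
  lia.
have h4 : delta <= p * m * deg n k (2 * t).
  by rewrite leq_mul2l (gap_anti gapK K0) ?orbT //; lia.
rewrite -(leq_add2r (p * p * deg n k (2 * t))); apply: (leq_trans _ (leq_trans h1 h2)).
by rewrite -addnA leq_add2l addnC (leq_trans _ h3) // mulnDl leq_add2l.
Qed.

Lemma union_ge : #|upset k D'| + #|C'| <= #|upset k D' :|: C'| + delta.
Proof. by rewrite -cardsUI leq_add2l; exact: (core_upset_le t0 (ltn0Sn 1) K0 gapK coreC' D'Y'). Qed.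

Hypothesis Gk : G \subset ksubsets n k.
Hypothesis GI : {in G &, forall A B : {set 'I_n}, t <= #|A :&: B|}.
Hypothesis Gnontriv :
  forall T : {set 'I_n}, #|T| = t -> exists2 A, A \in G & ~~ (T \subset A).
Hypothesis GD : {in G, forall A : {set 'I_n}, A \notin upset k D}.

(** Three cases: intersecting centers lose enough to pay for [delta]; disjoint centers avoiding [Y]
    are handled by a permutation; a center touching [Y] removes from [C] at least [deg n k (2 * t)]
    sets, again paying for [delta]. *)
Lemma core_case (Y : {set 'I_n}) (C : {set {set 'I_n}}) :
  core k t 1 Y C -> G \subset C -> #|upset k D| + #|G| <= #|upset k D' :|: C'|.
Proof.
move=> coreC GC.
have CC' : #|C| <= #|C'|.
  (* The cores alone are compared by taking no centers on either side. *)
  have z : trivIset (set0 : {set {set 'I_n}}) by apply/trivIsetP => A B; rewrite inE.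
  have u0 : upset k (set0 : {set {set 'I_n}}) = set0.
    by apply/setP => A; rewrite [RHS]inE; apply/upsetP => -[_ [T]]; rewrite inE.
  have := core_union_le t0 coreC coreC' z z erefl; rewrite u0 !set0U; apply.
    by move=> U; rewrite inE.
  by move=> U; rewrite inE.
have GC' := subset_leq_card GC; have hU := union_ge.
have [tD|/centers_lt] := boolP (trivIset D); last by lia.
have [h|] := boolP [forall U in D, [disjoint U & Y]].
  apply: leq_trans (core_union_le t0 coreC coreC' tD tD' cD _ D'Y'); last first.
    by move=> U UD; rewrite Dt //; have := forall_inP h U UD.
  rewrite -cardsUI (_ : _ :&: _ = set0) ?cards0 ?addn0.
    by apply: subset_leq_card; apply: setUS.
  by apply/setP => A; rewrite !in_set0 in_setI; apply/negP => /andP[AD /GD]; rewrite AD.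
case/forall_inPn => U UD dU.
have h1 := core_touch t0 (ltn0Sn 0) K0 gapK coreC (Dt UD) dU.
have h2 : #|G| <= #|C :\: upset k [set U]|.
  apply: subset_leq_card; apply/subsetP => A AG; rewrite in_setD (subsetP GC) // andbT.
  by apply: contra (GD AG); apply: subsetP; apply: upsetS; rewrite sub1set.
have h3 := cardsID (upset k [set U]) C.
have h4 : delta <= deg n k (2 * t).
  apply: gap_le gapK _ K0 _; [nia | lia].
have h5 : #|G| + delta <= #|C'|.
  by apply: leq_trans (leq_add h2 (leq_trans h4 h1)) _; rewrite addnC h3.
rewrite -(leq_add2r delta); apply: leq_trans hU.
by rewrite -addnA leq_add // centers_le.
Qed.

Lemma union_bound : #|upset k D| + #|G| <= #|upset k D' :|: C'|.
Proof.
have [h|[kt [W Wt GC]]|[kt [T [X [Tt Xk dTX GC]]]]] := intersecting_structure t0 tk tn Gk GI Gnontriv.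
(* [G] has leading coefficient at most [m - 1] against [m] for [C']. The spare [deg n k t.+1]
   absorbs all errors, which are of order [deg n k t.+2]. *)
- have h1 := core_card_ge t0 (isT : 0 < 2) K0 gapK coreC'.
  have h2 := union_ge; have h3 := centers_le; rewrite -/m in h h1.
  have h4 : ('C(k, t) * k * k + m * m + p * m) * deg n k t.+2 <= deg n k t.+1.
    by apply: gap_le gapK _ K0 _ => //; nia.
  have h5 : delta <= p * m * deg n k t.+2.
    by rewrite leq_mul2l (gap_anti gapK K0) ?orbT //; lia.
  have m0 : 0 < m by rewrite /m; lia.
  rewrite !mulnDl -mulnA in h4.
  have h6 : m * deg n k t.+1 = m.-1 * deg n k t.+1 + deg n k t.+1.
    by rewrite -{1}(prednK m0) mulSn addnC.
  rewrite mulnA in h. lia.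
- exact: core_case (CliqueCore 1 kt Wt) GC.
- exact: core_case (FlowerCore kt Tt Xk dTX) GC.
Qed.

End Comparison.

(** * Intervals and the explicit extremal family *)

Lemma card_itv n a b : 0 < a -> a <= b.+1 -> b <= n -> #|itv n a b| = b.+1 - a.
Proof.
move=> a0 ab bn.
have c1 j : j <= n -> #|[set i : 'I_n | i < j]| = j.
  move=> jn; rewrite -[RHS]card_ord -(card_imset predT (f := widen_ord jn)); last first.
    by move=> x y /(congr1 val) /= /val_inj.
  apply: eq_card => i; rewrite inE; apply/idP/imsetP => [ij|[x _ ->] /=]; last exact: ltn_ord.
  by exists (Ordinal ij) => //; apply: val_inj.
have -> : itv n a b = [set i : 'I_n | i < b] :\: [set i : 'I_n | i < a.-1].
  by apply/setP => i; rewrite !inE; lia.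
rewrite cardsDS ?c1 //; try lia.
by apply/subsetP => i; rewrite !inE; lia.
Qed.

Lemma itv_disjoint n a b c d : b < c -> [disjoint itv n a b & itv n c d].
Proof.
move=> bc; rewrite -setI_eq0; apply/eqP/setP => i; rewrite !inE; lia.
Qed.

Definition star_centers (n t s : nat) : {set {set 'I_n}} :=
  [set itv n ((r - 1) * t + 1) (r * t) | r : 'I_s in [set r : 'I_s | 0 < r]].

Lemma star_centers_props n t s : 0 < t -> 0 < s -> s * t <= n ->
  [/\ trivIset (star_centers n t s), #|star_centers n t s| = s.-1 &
    {in star_centers n t s, forall U : {set 'I_n}, #|U| = t /\
      forall b, [disjoint U & itv n ((s - 1) * t + 1) b]}].
Proof.
move=> t0 s0 stn.
have c (r : 'I_s) : 0 < r -> #|itv n ((r - 1) * t + 1) (r * t)| = t.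
  move=> r0; have rs := ltn_ord r; rewrite card_itv; nia.
have d (r r' : 'I_s) : r < r' ->
    [disjoint itv n ((r - 1) * t + 1) (r * t) & itv n ((r' - 1) * t + 1) (r' * t)].
  by move=> rr; apply: itv_disjoint; nia.
split.
- apply/trivIsetP => _ _ /imsetP[r _ ->] /imsetP[r' _ ->].
  have [rr _|rr _|/val_inj -> ] := ltngtP r r'; last by rewrite eqxx.
    exact: d.
  by rewrite disjoint_sym; exact: d.
- rewrite card_in_imset.
    have := cardsC1 (Ordinal s0); rewrite card_ord => <-.
    by apply: eq_card => r; rewrite !inE -val_eqE lt0n.
  move=> r r'; rewrite !inE => r0 r'0 e.
  have no (q q' : 'I_s) : 0 < q -> q < q' ->
      itv n ((q - 1) * t + 1) (q * t) = itv n ((q' - 1) * t + 1) (q' * t) -> False.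
    move=> q0 /d; rewrite -setI_eq0 => dq eq; move: dq; rewrite -eq setIid => /eqP z.
    by have := c q q0; rewrite z cards0; lia.
  have [rr|rr|/val_inj //] := ltngtP r r'; first by case: (no _ _ r0 rr).
  by case: (no _ _ r'0 rr).
move=> U /imsetP[r]; rewrite inE => r0 ->; split; first exact: c.
by move=> b; apply: itv_disjoint; have := ltn_ord r; nia.
Qed.

(** The split at [k <= 2 * t + 1] is the one made by a core with [b = 2]. An inclusion suffices,
    since only a lower bound on the extremal family is wanted. *)
Lemma extremal_family_core n k t s :
  0 < t -> t < k -> 0 < s -> s * t + k + 2 <= n ->
  exists Y C, [/\ core k t 2 Y C,
    {in star_centers n t s, forall U : {set 'I_n}, [disjoint U & Y]} &
    upset k (star_centers n t s) :|: C \subset extremal_family n k t s].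
Proof.
move=> t0 tk s0 stn.
have sS : upset k (star_centers n t s) \subset stars n k t s.
  apply/subsetP => A /upsetP[Ak [U /imsetP[r]]]; rewrite inE => r0 -> UA.
  by rewrite inE ksubsetsE Ak eqxx; apply/existsP; exists r; rewrite r0.
have stn' : s * t <= n by lia.
have [_ _ dS] := star_centers_props t0 s0 stn'.
have st : s * t = (s - 1) * t + t by rewrite -mulSnr subn1 prednK.
rewrite st in stn.
rewrite /extremal_family; case: leqP => [kt|kt].
  exists (itv n ((s - 1) * t + 1) (s * t + 2)), (clique_family k t (itv n ((s - 1) * t + 1) (s * t + 2))).
  split; [apply: CliqueCore => // | by move=> U /dS[_] | exact: setSU].
  by rewrite st; move: ((s - 1) * t) stn => q stn; rewrite card_itv; lia.
pose T := itv n ((s - 1) * t + 1) (s * t).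
pose X := itv n (s * t + 1) ((s - 1) * t + k + 1).
have TX : T :|: X = itv n ((s - 1) * t + 1) ((s - 1) * t + k + 1).
  by apply/setP => i; rewrite !inE st; move: ((s - 1) * t) => q; lia.
exists (T :|: X), (flower_family k T X); split.
- apply: FlowerCore; first lia.
  + by rewrite /T st; move: ((s - 1) * t) stn => q stn; rewrite card_itv; lia.
  + by rewrite /X st; move: ((s - 1) * t) stn => q stn; rewrite card_itv; lia.
  + by apply: itv_disjoint; lia.
- by move=> U /dS[_]; rewrite TX.
rewrite -setUA; apply: setUSS => //; apply: setUSS; last first.
  apply/subsetP => _ /imsetP[i iT ->]; rewrite TX; apply: imset_f.
  by rewrite -TX inE iT.
apply/subsetP => A /upsetP[Ak [B /imsetP[x xX ->]]]; rewrite subUset sub1set => /andP[xA TA].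
by rewrite inE ksubsetsE Ak eqxx TA /=; apply/set0Pn; exists x; rewrite inE xA.
Qed.

Theorem theorem1p4 (k t s : nat) (ht : 1 <= t) (htk : t < k) (hs : 1 <= s)
    (hk : 3 <= k) :
  exists n0 : nat, forall n : nat, n0 <= n ->
    forall F : {set {set 'I_n}}, F \subset ksubsets n k ->
      nu t F = s -> s < tau t F ->
      #|F| <= #|extremal_family n k t s|.
Proof.
pose m := maxn t.+2 (k - t + 1).
pose c := s.+1 * (k + t).
(* The first two summands serve the comparison of cores, where there are [s - 1] centers; the last
   two serve the case of fewer heavy sets. *)
pose K := 'C(k, t) * k * k + (m + s) * (m + s) + s * 'C(k, t) * c + s * s.
(* The first part makes the explicit intervals fit into the ground set; the second yields
   [gap n k K]. *)
exists (s * t + k + 2 + (K * k + k)) => n nn F Fk nuF tauF.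
have gapK : gap n k K by move=> j; apply: leq_deg_mul; lia.
have K0 : 0 < K by rewrite /K addn_gt0 (muln_gt0 s s) hs orbT.
have stkn : s * t + k + 2 <= n by lia.
have [Y [C [coreC CY CE]]] := extremal_family_core ht htk hs stkn.
have stn : s * t <= n by lia.
have [tS cS St] := star_centers_props ht hs stn.
have SY : {in star_centers n t s, forall U : {set 'I_n}, #|U| = t /\ [disjoint U & Y]}.
  by move=> U US; have [-> _] := St U US; split=> //; exact: CY.
have := @heavy_reduction n k t F Fk (ltnW htk); rewrite nuF -/c => /(_ tauF).
set H := heavy _ _ _ _ => -[Hs Gle HG].
have Ht : {in H, forall U : {set 'I_n}, #|U| = t} by move=> U /heavyP[].
have hF : #|F| <= #|upset k H| + #|F :\: upset k H|.
  by rewrite -(cardsID (upset k H) F) leq_add2r subset_leq_card // subsetIr.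
apply: leq_trans hF (leq_trans _ (subset_leq_card CE)).
(* With fewer than [s - 1] heavy sets, the stars alone win: one missing [deg n k t] outweighs the
   rest of [F] and the overlaps of the stars, all of order [deg n k t.+1]. *)
have [Hs'|sH] := ltnP #|H| s.-1.
  apply: (leq_trans _ (subset_leq_card (subsetUl _ _))).
  have h1 := @disjoint_upset_ge n k t _ _ tS SY; rewrite cS in h1.
  have h2 : #|upset k H| <= #|H| * deg n k t by apply: card_upset_le => U /Ht ->.
  have h3 : (s * 'C(k, t) * c + s * s) * deg n k t.+1 <= deg n k t.
    by apply: gap_le gapK _ K0 _ => //; rewrite /K; lia.
  have h4 : deg n k (2 * t) <= deg n k t.+1 by apply: (gap_anti gapK K0); lia.
  have h5 : s.-1 * s.-1 * deg n k (2 * t) <= s * s * deg n k t.+1.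
    by rewrite leq_mul // leq_mul // leq_pred.
  have h6 : #|H| * deg n k t + deg n k t <= s.-1 * deg n k t.
    by rewrite -mulSnr leq_mul2r Hs' orbT.
  rewrite -(leq_add2r (s * s * deg n k t.+1)).
  have h7 : s.-1 * deg n k t <= #|upset k (star_centers n t s)| + s * s * deg n k t.+1.
    by apply: leq_trans h1 _; rewrite leq_add2l.
  apply: (leq_trans _ h7).
  apply: (leq_trans _ h6); rewrite -addnA leq_add //; apply: (leq_trans _ h3).
  by rewrite mulnDl leq_add2r -mulnA.
have cH : #|H| = s.-1 by apply/eqP; rewrite eqn_leq sH andbT -ltnS prednK.
have [GI Gn] := HG cH.
apply: (union_bound (K := K) ht htk _ gapK _ coreC tS _ Ht SY) => //.
- lia.
- rewrite cS /K -!addnA leq_add2l; apply: (leq_trans _ (leq_addr _ _)).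
  by rewrite leq_mul // leq_add2l leq_pred.
- by rewrite cH cS.
- by apply/subsetP => A /setDP[AF _]; exact: (subsetP Fk).
- by move=> A /setDP[].
Qed.
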